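(* Consider the network of single integrators $\dot{\mathbf{x}}(t)=A\mathbf{x}(t)+B\mathbf{w}(t)$, $t>t_0$, with $A$ an in-weighting on the digraph $\mathcal{G}$, with output equation $y_p(t)=x_p(t)$ at node $\nu_p$, and assume that the link $\bar\epsilon=(\nu_j,\nu_i)\in\mathcal{E}$ fails at time $t_f>t_0$, so that for $t>t_f$ the matrix $A$ is replaced by $\bar A$ (as specified in the context). Then the output of node $\nu_p$ satisfies, for orders $k\in\{1,\dots,z\}$: $$\Delta_{t_f}(p,k)=\Phi\big(\Omega^{k-1}(\nu_i,\nu_p),A\big)\sum_{q=1}^{n}\left(\bar a_{iq}-a_{iq}\right)x_q(t_f)\quad\text{for } k=\mathrm{dist}(\nu_j,\nu_p),$$ and $$\Delta_{t_f}(p,k)=0\quad\text{for } k<\mathrm{dist}(\nu_j,\nu_p).$$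
   Context: **Graphs and walks.** $\mathcal{G}=(\mathcal{V},\mathcal{E})$ is a digraph with vertices $\mathcal{V}=\{\nu_1,\dots,\nu_n\}$ and directed edges $\mathcal{E}\subseteq\mathcal{V}\times\mathcal{V}$ (self-loops allowed); the edge $(\tau,\nu)$ goes from its tail $\tau$ to its head $\nu$. A $\tau\nu$ walk is a sequence of consecutive edges of $\mathcal{G}$ starting at $\tau$ and ending at $\nu$ (vertices and edges may repeat); its length is the number of edges. $\Omega^{k}(\nu_q,\nu_p)=\Omega^{k}(\mathcal{G};\nu_q,\nu_p)$ is the set of all $\nu_q\nu_p$ walks of length $k$ in $\mathcal{G}$; for $k=0$ it consists of the single empty walk if $q=p$ and is empty otherwise. $\mathrm{dist}(\nu_q,\nu_p)$ is the minimal $k\ge 1$ with $\Omega^{k}(\nu_q,\nu_p)\neq\varnothing$ when $q\ne p$ and such $k$ exists, $\mathrm{dist}(\nu_q,\nu_q)=0$, and $\mathrm{dist}(\nu_q,\nu_p)=\infty$ if no walk exists. $\mathrm{diam}(\mathcal{G})=\max_{\nu_q,\nu_p\in\mathcal{V}}\mathrm{dist}(\nu_q,\nu_p)$. **In-weightings.** $A=(a_{pq})\in\mathbb{R}^{n\times n}$ is an in-weighting on $\mathcal{G}$ if $(\nu_q,\nu_p)\notin\mathcal{E}$ implies $a_{pq}=0$. The weight of a walk $\mathcal{W}$ is $\omega(\mathcal{W},A)=\prod_{(\nu_q,\nu_p)\in\mathcal{W}}a_{pq}$ (product over the edges of the walk, with multiplicity; the empty walk has weight $1$), and for a set $\Omega$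 of walks $\Phi(\Omega,A)=\sum_{\mathcal{W}\in\Omega}\omega(\mathcal{W},A)$. Thus $\Phi(\Omega^{k}(\nu_q,\nu_p),A)=[A^{k}]_{pq}$. **Dynamics and failure.** $\mathbf{x}(t)=(x_1,\dots,x_n)^T\in\mathbb{R}^n$, $\mathbf{w}(t)\in\mathbb{R}^m$, $B\in\mathbb{R}^{n\times m}$, and the entries of $\mathbf{w}$ are $(\mathrm{diam}(\mathcal{G})+1)$-times differentiable (infinitely differentiable if $\mathrm{diam}(\mathcal{G})=\infty$). When the link $\bar\epsilon=(\nu_j,\nu_i)$ fails at $t_f$, the graph for $t>t_f$ is $\bar{\mathcal{G}}=(\mathcal{V},\mathcal{E}\setminus\{\bar\epsilon\})$, and the dynamics become $\dot{\mathbf{x}}(t)=\bar A\mathbf{x}(t)+B\mathbf{w}(t)$, where $\bar A$ is an in-weighting on $\bar{\mathcal{G}}$ with $\bar a_{ij}=0$ and $\bar a_{qr}=a_{qr}$ for all $q\ne i$ and all $r$ (the other entries of the $i$-th row may change arbitrarily subject to being an in-weighting on $\bar{\mathcal{G}}$). The state $\mathbf{x}$ is continuous at $t_f$. **Jumps.** $z\le\mathrm{diam}(\mathcal{G})+1$ is a fixed positive integer, and for $p\in\{1,\dots,n\}$, $k\in\{1,\dots,z\}$, $$\Delta_{t_f}(p,k)=\frac{d^k x_p}{dt^k}(t_f^{+})-\frac{d^k x_p}{dt^k}(t_f^{-}).$$ *)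

(* Defs.v *)
From HB Require Import structures.
From mathcomp Require Import all_boot all_order all_algebra.
From mathcomp Require Import all_classical all_reals all_analysis.

Set Implicit Arguments.
Unset Strict Implicit.
Unset Printing Implicit Defensive.

Import Order.TTheory GRing.Theory Num.Theory.
Import numFieldNormedType.Exports.

Local Open Scope ring_scope.

(* A digraph on the vertices 'I_n is its set of edges; the edge (q, p) has
   tail q and head p. *)
Definition digraph (n : nat) := {set 'I_n * 'I_n}.

Section Walks.
Variable n : nat.
Implicit Types (G : digraph n) (q p : 'I_n).

Fixpoint is_walk G q (s : seq ('I_n * 'I_n)) p : bool :=
  if s is e :: s' then [&& e \in G, e.1 == q & is_walk G e.2 s' p] else q == p.

Definition Omega G (k : nat) q p : {set k.-tuple ('I_n * 'I_n)} :=
  [set s : k.-tuple ('I_n * 'I_n) | is_walk G q s p].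

(* Distances are extended integers, +oo meaning that there is no walk. *)
Definition dist G q p : \bar int :=
  if q == p then 0%E else
  match pselect (exists k, (0 < k)%N && (Omega G k q p != finset.set0)) with
  | left walk_qp => (ex_minn walk_qp)%:Z%:E
  | right _ => +oo%E
  end.

Definition diam G : \bar int :=
  \big[maxe/-oo%E]_(q < n) \big[maxe/-oo%E]_(p < n) dist G q p.

End Walks.

Section Weights.
Variables (R : realType) (n : nat).
Implicit Types (G : digraph n) (A : 'M[R]_n).

(* The entry A p q weighs the edge from q to p. *)
Definition in_weighting G A :=
  forall p q : 'I_n, (q, p) \notin G -> A p q = 0.

Definition weight A (s : seq ('I_n * 'I_n)) : R := \prod_(e <- s) A e.2 e.1.

Definition Phi (k : nat) (W : {set k.-tuple ('I_n * 'I_n)}) A : R :=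
  \sum_(s in W) weight A s.

(* The edge (j, i) is removed from G: only row i of the weights may change. *)
Definition link_failure G (j i : 'I_n) A Abar :=
  [/\ in_weighting (G :\ (j, i)) Abar,
      Abar i j = 0
    & forall q r : 'I_n, q != i -> Abar q r = A q r].

End Weights.

Local Open Scope classical_set_scope.

Section Jumps.
Variable R : realType.
Implicit Types (f : R -> R) (D : set R) (t : R) (k : nat).

(* f^`(l) is a total function, meaningful where f is l times derivable; D is
   meant to be open. *)
Definition derivable_upto k D f :=
  forall l, (l < k)%N -> forall t, D t -> derivable (f^`(l)) t 1.

(* f is k times derivable around t, except perhaps at t, and its k-th derivative
   has finite one-sided limits at t. *)
Definition has_jump f t k :=
  [/\ \forall s \near t^', forall l, (l < k)%N -> derivable (f^`(l)) s 1,
      cvg (f^`(k) @ t^'+)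
    & cvg (f^`(k) @ t^'-)].

(* Meaningful only if has_jump f t k. *)
Definition jump f t k : R := lim (f^`(k) @ t^'+) - lim (f^`(k) @ t^'-).

End Jumps.

Definition output (R : realType) (n : nat) (x : R -> 'cV[R]_n) (p : 'I_n) :
  R -> R := fun t => x t p 0.

(* Main.v *)
Require Import Defs.
From HB Require Import structures.
From mathcomp Require Import all_boot all_order all_algebra.
From mathcomp Require Import all_classical all_reals all_analysis.
Import Order.TTheory GRing.Theory Num.Theory.
Import numFieldNormedType.Exports.
Local Open Scope classical_set_scope.
Local Open Scope ring_scope.

(** Differentiating x' = M x + B w gives, for the successive derivatives,
    x^(l+1) = M x^(l) + B w^(l).  As x and the derivatives of w are continuous at
    the failure time tf, letting t tend to tf from either side turns this into a
    recursion for the one-sided limits X_l of x^(l), with X_0 = x(tf): M is A on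
    the left and Abar on the right, and the input terms are the same
    ([cvg_derivative_limit], [jump_switched_ode]).

    Subtracting the two recursions, the input terms cancel and the jump D_l of
    x^(l) satisfies D_(l+1) = A D_l + (Abar - A) X_l with X_l taken on the right,
    whence D_k = \sum_(s < k) A^s (Abar - A) X_(k-1-s) ([derivative_limitB]).

    Only row i of Abar - A is nonzero, so entry p of the term of index s carries
    the factor [A^s]_pi ([mulmx_failure]), which is the total weight of the walks of
    length s from i to p ([Phi_Omega]).  Preceded by the edge (j, i), such a walk
    becomes a walk of length s + 1 from j to p, so the factor vanishes as soon as
    s + 1 < dist(j, p) ([expmx_eq0_dist]).  When k < dist(j, p) no term survives;
    when k = dist(j, p) only s = k - 1 does, and its other factor involves
    X_0 = x(tf). *)

(** * Walks and matrix powers *)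

Lemma Phi_Omega0 {R : realType} {n : nat} (G : digraph n) (q p : 'I_n)
    (A : 'M[R]_n) : Phi (Omega G 0 q p) A = (q == p)%:R.
Proof.
rewrite /Phi big_mkcond /=.
rewrite (big_pred1 [tuple]) => [|s]; last by apply/esym/eqP/val_inj; case: s => -[].
by rewrite inE /= /weight big_nil; case: eqP.
Qed.

(** A nonempty walk is its first edge followed by a walk from the head of that
    edge.  No edge condition remains in the sum because an in-weighting vanishes
    off the edges. *)
Lemma Phi_OmegaS {R : realType} {n : nat} (G : digraph n) (A : 'M[R]_n)
    (k : nat) (q p : 'I_n) : in_weighting G A ->
  Phi (Omega G k.+1 q p) A = \sum_(v < n) Phi (Omega G k v p) A * A v q.
Proof.
move=> hA; rewrite /Phi big_mkcond /=.
pose cons_edge (es : ('I_n * 'I_n) * k.-tuple ('I_n * 'I_n)) :=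
  [tuple of es.1 :: es.2].
rewrite (reindex cons_edge) /=; last first.
  exists (fun s : k.+1.-tuple ('I_n * 'I_n) => (thead s, [tuple of behead s])).
    by move=> [e s] _; congr pair; apply: val_inj.
  by move=> s _; rewrite /cons_edge /= [RHS]tuple_eta.
pose term a v (s : k.-tuple ('I_n * 'I_n)) :=
  if cons_edge ((a, v), s) \in Omega G k.+1 q p
  then weight A (cons_edge ((a, v), s)) else 0.
rewrite (eq_bigr (fun es => term es.1.1 es.1.2 es.2)) => [|[[a v] s] //].
rewrite -(pair_bigA _ (fun e s => term e.1 e.2 s)) /=.
rewrite -(pair_bigA _ (fun a v => \sum_s term a v s)) /= /term.
rewrite (bigD1 q) //= [X in _ + X]big1 ?addr0 => [|a aq]; last first.
  by apply: big1 => v _; apply: big1 => s _; rewrite inE /= (negbTE aq) andbF.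
apply: eq_bigr => v _; rewrite mulr_suml [RHS]big_mkcond /=.
apply: eq_bigr => s _; rewrite !inE /= eqxx /= /weight big_cons /= mulrC.
case: (boolP (_ \in G)) => //= not_edge.
by rewrite (hA _ _ not_edge) mulr0; case: ifP.
Qed.

Lemma Phi_Omega {R : realType} {n : nat} (G : digraph n) (A : 'M[R]_n)
    (k : nat) (q p : 'I_n) : in_weighting G A ->
  Phi (Omega G k q p) A = (A ^+ k) p q.
Proof.
move=> hA; elim: k q => [|k IHk] q.
  by rewrite Phi_Omega0 expr0 mxE eq_sym.
rewrite Phi_OmegaS // exprSr mxE.
by apply: eq_bigr => v _; rewrite IHk.
Qed.

Lemma dist_le_walk {n : nat} (G : digraph n) (q p : 'I_n) (k : nat) :
  (0 < k)%N -> Omega G k q p != finset.set0 -> (dist G q p <= k%:Z%:E)%E.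
Proof.
move=> k_gt0 walk_k; rewrite /dist; case: ifP => _; first by rewrite lee_fin.
case: pselect => [walk_qp|[]]; last by exists k; rewrite k_gt0.
by rewrite lee_fin lez_nat; case: ex_minnP => l _; apply; rewrite k_gt0.
Qed.

(** A walk of length s from i to p, preceded by the edge (j, i), would be a walk
    from j to p shorter than the distance. *)
Lemma expmx_eq0_dist {R : realType} {n : nat} {G : digraph n} {A : 'M[R]_n}
    {i j p : 'I_n} {s : nat} : in_weighting G A -> (j, i) \in G ->
  (s.+1%:Z%:E < dist G j p)%E -> (A ^+ s) p i = 0.
Proof.
move=> hA hji; rewrite -(Phi_Omega _ _ _ _ _ hA) ltNge => far.
have [->|[u]] := set_0Vmem (Omega G s i p); first by rewrite /Phi big_set0.
rewrite inE => walk_u; case/negP: far; apply: dist_le_walk => //.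
by apply/set0Pn; exists [tuple of (j, i) :: u]; rewrite inE /= hji eqxx.
Qed.

(** * The recursion for the one-sided limits *)

(** The one-sided limit at the switching time of the l-th derivative of a solution
    of x' = M x + v, where x0 is the value of x there and u l that of the l-th
    derivative of v. *)
Fixpoint derivative_limit {R : realType} {n : nat} (M : 'M[R]_n)
    (u : nat -> 'cV[R]_n) (x0 : 'cV[R]_n) (l : nat) : 'cV[R]_n :=
  if l is l'.+1 then M *m derivative_limit M u x0 l' + u l' else x0.

(** The difference of the two sequences obeys a recursion in which the inputs have
    cancelled.  Expanding around A, rather than Abar, leaves only powers of A, which
    is what makes walks of the intact graph appear. *)
Lemma derivative_limitB {R : realType} {n : nat} (A Abar : 'M[R]_n)
    (u : nat -> 'cV[R]_n) (x0 : 'cV[R]_n) (k : nat) :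
  derivative_limit Abar u x0 k - derivative_limit A u x0 k =
  \sum_(s < k) A ^+ s *m
    ((Abar - A) *m derivative_limit Abar u x0 (k - s.+1)).
Proof.
elim: k => [|k IHk] /=; first by rewrite subrr big_ord0.
rewrite opprD addrACA subrr addr0 big_ord_recl /= expr0 mul1mx subn1 /=.
under eq_bigr => s _ do rewrite /bump /= add1n subSS exprS -mulmxE -mulmxA.
by rewrite -mulmx_sumr -IHk mulmxBl mulmxBr addrA subrK.
Qed.

(** Abar - A is supported on row i, so the product is column i of C times a
    scalar. *)
Lemma mulmx_failure {R : realType} {n : nat} (C A Abar : 'M[R]_n)
    (i p : 'I_n) (v : 'cV[R]_n) :
    (forall q r : 'I_n, q != i -> Abar q r = A q r) ->
  (C *m ((Abar - A) *m v)) p 0 =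
    C p i * \sum_(q < n) (Abar i q - A i q) * v q 0.
Proof.
move=> eq_rows; rewrite mxE (bigD1 i) //= big1 ?addr0 => [|r ri].
  by rewrite !mxE; congr (_ * _); apply: eq_bigr => q _; rewrite !mxE.
rewrite mxE big1 ?mulr0 // => q _.
by rewrite !mxE eq_rows // subrr mul0r.
Qed.

(** * Differentiating the linear system *)

Section ODE.
Context {R : realType} {n m : nat}.
(* Scalar components, since the outputs and the regularity of the inputs are
   both given componentwise. *)
Variables (M : 'M[R]_n) (B : 'M[R]_(n, m)).
Variables (y : 'I_n -> R -> R) (v : 'I_m -> R -> R).

Let rhs (l : nat) (q : 'I_n) (t : R) : R :=
  \sum_r M q r * ((y r)^`(l)%classic t) + \sum_r B q r * ((v r)^`(l)%classic t).

(** Each differentiation of the equation consumes one derivative of v, so the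
    equation of order l is reached as soon as the derivatives of v of order less
    than l are derivable; this is why l = k is included. *)
Lemma is_derive_ode (D : set R) (k : nat) : open D ->
    (forall q t, D t -> is_derive t 1 (y q) (rhs 0 q t)) ->
    (forall r, derivable_upto k D (v r)) ->
  forall l, (l <= k)%N -> forall q t, D t ->
  is_derive t 1 ((y q)^`(l)%classic) (rhs l q t).
Proof.
move=> openD ode vk; elim=> [//|l IHl] lk q t Dt.
(* D is open, so the equation of order l holds near t and can be
   differentiated. *)
have rhs_near : \near t, rhs l q t = (y q)^`(l.+1)%classic t.
  near=> s; have Ds : D s by near: s; exact: open_nbhs_nbhs.
  have yl := IHl (ltnW lk) q s Ds.
  by rewrite derive1nS derive1E derive_val.
apply: near_eq_is_derive rhs_near _.
have -> : rhs l q = \sum_r (M q r \*: (y r)^`(l)%classic) + \sum_r (B q r \*: (v r)^`(l)%classic).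
  by apply/funext => s; rewrite /rhs !fctE !fct_sumE.
apply: is_deriveD; apply: is_derive_sum => r; apply: is_deriveZ.
  have yl := IHl (ltnW lk) r t Dt.
  by rewrite derive1nS derive1E; apply/derivableP.
by rewrite derive1nS derive1E; apply/derivableP/vk.
Unshelve. all: by end_near. Qed.

(** The filter F stands for the left or the right neighbourhoods of the switching
    time, which itself need not lie in D. *)
Lemma cvg_derivative_limit (D : set R) (k : nat) (F : set_system R)
    (x0 : 'cV[R]_n) (v0 : nat -> 'cV[R]_m) : Filter F -> open D -> F D ->
    (forall q t, D t -> is_derive t 1 (y q) (rhs 0 q t)) ->
    (forall r, derivable_upto k D (v r)) ->
    (forall q, y q t @[t --> F] --> x0 q 0) ->
    (forall l r, (l < k)%N -> (v r)^`(l)%classic t @[t --> F] --> v0 l r 0) ->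
  forall l, (l <= k)%N -> forall q,
  (y q)^`(l)%classic t @[t --> F] -->
    derivative_limit M (fun l => B *m v0 l) x0 l q 0.
Proof.
move=> FF openD FD ode vk y0 v0P; elim=> [_ q|l IHl lk q]; first exact: y0.
have rhs_near : \forall t \near F, rhs l q t = (y q)^`(l.+1)%classic t.
  apply: filterS FD => t Dt.
  have yl := is_derive_ode D k openD ode vk l (ltnW lk) q t Dt.
  by rewrite derive1nS derive1E derive_val.
apply: cvg_trans (near_eq_cvg rhs_near) _.
rewrite /rhs /= !mxE.
apply: cvgD; (apply: cvg_big; first exact: add_continuous) => r _; apply: cvgMr.
  exact: IHl (ltnW lk) r.
exact: v0P.
Qed.

End ODE.

Lemma is_derive_coord {R : realType} {n : nat} (x : R -> 'cV[R]_n) (t : R)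
    (dx : 'cV[R]_n) (q : 'I_n) :
  is_derive t 1 x dx -> is_derive t 1 (output x q) (dx q 0).
Proof.
move=> [x_der <-]; rewrite derive_mx // mxE.
by apply/derivableP; have /derivable_mxP := x_der; apply.
Qed.

(** * The jumps *)

Lemma has_jump_cvg {R : realType} (f : R -> R) (t a b : R) (k : nat) :
    (\forall s \near t^', forall l, (l < k)%N -> derivable (f^`(l)%classic) s 1) ->
    f^`(k)%classic s @[s --> t^'+] --> a -> f^`(k)%classic s @[s --> t^'-] --> b ->
  has_jump f t k /\ jump f t k = a - b.
Proof.
move=> der fa fb; split; first by split=> //; apply/cvg_ex; [exists a|exists b].
by rewrite /jump (cvg_lim _ fa) // (cvg_lim _ fb).
Qed.

(** Both sides of the switch share x(tf) and the derivatives of w at tf; only the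
    matrix of the recursion changes. *)
Lemma jump_switched_ode {R : realType} {n m : nat} (A Abar : 'M[R]_n)
    (B : 'M[R]_(n, m)) (x : R -> 'cV[R]_n) (w : R -> 'cV[R]_m) (t0 tf : R)
    (k : nat) (p : 'I_n) : t0 < tf ->
    (forall r, derivable_upto k [set t | t0 < t] (output w r)) ->
    (forall t, t0 < t < tf -> is_derive t (1 : R) x (A *m x t + B *m w t)) ->
    (forall t, tf < t -> is_derive t (1 : R) x (Abar *m x t + B *m w t)) ->
    {for tf, continuous x} ->
  let X M := derivative_limit M
    (fun l => B *m \col_r (output w r)^`(l)%classic tf) (x tf) in
  has_jump (output x p) tf k /\
    jump (output x p) tf k = (X Abar k - X A k) p 0.
Proof.
move=> htf wk hx_before hx_after hx_cont X.
pose after := [set t : R | tf < t]; pose before := [set t : R | t0 < t < tf].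
have open_after : open after by exact: open_gt.
have open_before : open before.
  rewrite (_ : before = [set t | t0 < t] `&` [set t | t < tf]).
    by apply: openI; [exact: open_gt|exact: open_lt].
  by apply/seteqP; split=> t /= => [/andP[]|[t0t ttf]] //; apply/andP.
have ode (M : 'M[R]_n) t :
    is_derive t (1 : R) x (M *m x t + B *m w t) -> forall q,
    is_derive t 1 (output x q) (\sum_r M q r * output x r t +
      \sum_r B q r * output w r t).
  by move=> xt q; have := is_derive_coord x t _ q xt; rewrite !mxE.
have wk_after r : derivable_upto k after (output w r).
  by move=> l lk t tft; apply: wk lk _ _; exact: lt_trans htf tft.
have wk_before r : derivable_upto k before (output w r).
  by move=> l lk t /andP[t0t _]; exact: wk lk _ t0t.
pose w0 l : 'cV[R]_m := \col_r (output w r)^`(l)%classic tf.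
have cvg_x (F : set_system R) : F --> tf -> forall q,
    output x q t @[t --> F] --> x tf q 0.
  move=> Ftf q; apply: cvg_trans (cvg_app _ Ftf) _.
  have := @coord_continuous R n 1 q 0 (x tf).
  exact: continuous_comp hx_cont.
have cvg_w (F : set_system R) : F --> tf -> forall l r, (l < k)%N ->
    (output w r)^`(l)%classic t @[t --> F] --> w0 l r 0.
  move=> Ftf l r lk; apply: cvg_trans (cvg_app _ Ftf) _.
  rewrite mxE; apply: differentiable_continuous; apply/derivable1_diffP.
  exact: wk lk _ htf.
have right_tf : tf^'+ --> tf by exact: cvg_within.
have left_tf : tf^'- --> tf by exact: cvg_within.
have right_filter : Filter tf^'+ by exact: at_right_proper_filter.
have left_filter : Filter tf^'- by exact: at_left_proper_filter.
have after_right : tf^'+ after by exact: nbhs_right_gt.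
have before_left : tf^'- before.
  by near=> t; apply/andP; split; near: t; [exact: nbhs_left_gt|exact: nbhs_left_lt].
have ode_after q t : after t -> _ := fun tft => ode Abar t (hx_after t tft) q.
have ode_before q t : before t -> _ := fun bt => ode A t (hx_before t bt) q.
have lim_after := cvg_derivative_limit Abar B (output x) (output w) after k _
  (x tf) w0 right_filter open_after after_right ode_after wk_after (cvg_x _ right_tf)
  (cvg_w _ right_tf) k (leqnn k) p.
have lim_before := cvg_derivative_limit A B (output x) (output w) before k _
  (x tf) w0 left_filter open_before before_left ode_before wk_before (cvg_x _ left_tf)
  (cvg_w _ left_tf) k (leqnn k) p.
have der : \forall s \near tf^', forall l, (l < k)%N ->
    derivable ((output x p)^`(l)%classic) s 1.
  near=> s => l lk.
  have [s_tf|tf_s|s_eq] := ltgtP s tf.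
  - have bs : before s.
      by apply/andP; split=> //; near: s; apply: nbhs_dnbhs; exact: lt_nbhsr.
    have xs := is_derive_ode A B _ _ before k open_before ode_before wk_before
      l (ltnW lk) p s bs.
    exact: ex_derive.
  - have xs := is_derive_ode Abar B _ _ after k open_after ode_after wk_after
      l (ltnW lk) p s tf_s.
    exact: ex_derive.
  - suff : s != tf by rewrite s_eq eqxx.
    by near: s; exact: nbhs_dnbhs_neq.
by rewrite !mxE; exact: has_jump_cvg _ _ _ _ _ der lim_after lim_before.
Unshelve. all: by end_near. Qed.

Theorem theorem1 (R : realType) (n m : nat) (G : digraph n)
    (A Abar : 'M[R]_n) (B : 'M[R]_(n, m))
    (x : R -> 'cV[R]_n) (w : R -> 'cV[R]_m) (t0 tf : R)
    (i j p : 'I_n) (z : nat)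
    (hA : in_weighting G A)
    (hji : (j, i) \in G)
    (hAbar : link_failure G j i A Abar)
    (htf : t0 < tf)
    (hw : forall (r : 'I_m) (k : nat), (k%:Z%:E <= diam G + 1)%E ->
      derivable_upto k [set t | t0 < t] (fun t => w t r 0))
    (hx_before : forall t, t0 < t < tf ->
      is_derive t (1 : R) x (A *m x t + B *m w t))
    (hx_after : forall t, tf < t ->
      is_derive t (1 : R) x (Abar *m x t + B *m w t))
    (hx_cont : {for tf, continuous x})
    (hz0 : (0 < z)%N)
    (hz : (z%:Z%:E <= diam G + 1)%E) :
  forall k : nat, (1 <= k <= z)%N ->
    [/\ has_jump (output x p) tf k,
        k%:Z%:E = dist G j p ->
          jump (output x p) tf k =
            Phi (Omega G k.-1 i p) A *
              \sum_(q < n) (Abar i q - A i q) * x tf q 0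
      & (k%:Z%:E < dist G j p)%E -> jump (output x p) tf k = 0].
Proof.
move=> k /andP[k_gt0 kz]; have [_ _ eq_rows] := hAbar.
have wk r : derivable_upto k [set t | t0 < t] (output w r).
  by move=> l lk; apply: (hw r z hz); exact: leq_trans lk kz.
have [xp_jump ->] := jump_switched_ode A Abar B x w t0 tf k p htf wk
  hx_before hx_after hx_cont.
rewrite derivative_limitB summxE.
under eq_bigr => s _ do rewrite (mulmx_failure _ _ _ i) //.
split=> // [k_dist|k_dist].
  case: k k_gt0 k_dist {kz wk xp_jump} => // k _ k_dist.
  rewrite big_ord_recr /= subnn (Phi_Omega _ _ _ _ _ hA) big1 ?add0r // => s _.
  by rewrite (expmx_eq0_dist hA hji) ?mul0r // -k_dist lte_fin ltz_nat ltnS.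
apply: big1 => s _; rewrite (expmx_eq0_dist hA hji) ?mul0r //.
by apply: le_lt_trans k_dist; rewrite lee_fin lez_nat.
Qed.
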